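(* Let $m\in\mathbb{Z}$, write $t^2-t+m=(t-a)(t-b)$ with $a,b\in\mathbb{C}$, and put $L_n=a^n+b^n$ for $n\in\mathbb{Z}_{\geq 0}$ (so $L_n\in\mathbb{Z}$). (i) If $2^3$ divides $L_{2n+1}$ for some $n\in\mathbb{Z}_{\geq 0}$, then $4m^2-m\equiv 1\pmod 8$. (ii) If an odd prime number $p$ divides $L_{2n+1}$ for some $n\in\mathbb{Z}_{\geq 0}$, then the Legendre symbol satisfies $\left(\dfrac{4m^2-m}{p}\right)=1$.
   Context: The sequence satisfies $L_0=2$, $L_1=1$, $L_{n+2}=L_{n+1}-mL_n$. The Legendre symbol $\left(\frac{c}{p}\right)$ is $0$ if $p\mid c$, is $1$ if $p\nmid c$ and $c$ is a square mod $p$, and is $-1$ otherwise. *)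

(* Defs.v *)
From mathcomp Require Import all_boot all_order all_algebra.

Set Implicit Arguments.
Unset Strict Implicit.
Unset Printing Implicit Defensive.

Local Open Scope ring_scope.

(* Whether [c] is a square mod [p] is tested on the representatives
   [0, ..., p - 1] of the residue classes. *)
Definition legendre (c : int) (p : nat) : int :=
  if (p%:Z %| c)%Z then 0
  else if [exists x : 'I_p, ((x : nat)%:Z ^+ 2 == c %[mod p%:Z])%Z] then 1
  else -1.

(* Main.v *)
(** The Lucas sequences U, L of (1, m) satisfy L_n^2 + (4m-1) U_n^2 = 4 m^n.
    If p is odd and divides L_N with N = 2n+1, multiplying by m gives
    (4m^2 - m) U_N^2 = (2 m^(n+1))^2 mod p, and p does not divide m because
    L_N = 1 mod m; hence 4m^2 - m is a nonzero square mod p.  If 8 divides L_N,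
    then m is odd for the same reason, U_N is twice an odd number, and dividing
    the identity by 4 gives 4m - 1 = m mod 8. *)
Require Import Defs.
From mathcomp Require Import all_boot all_order all_algebra.
From mathcomp Require Import reals complex.
From mathcomp Require Import ring zify.

Set Implicit Arguments.
Unset Strict Implicit.
Unset Printing Implicit Defensive.

Import GRing.Theory.

Local Open Scope ring_scope.

Fixpoint lucasU (m : int) (n : nat) : int :=
  match n with
  | 0%N => 0
  | n'.+1 => if n' is n''.+1 then lucasU m n' - m * lucasU m n'' else 1
  end.

(** Written through [lucasU], so that identities about L become polynomial identities in two
    consecutive terms of U. *)
Definition lucasL (m : int) (n : nat) : int := lucasU m n.+1 *+ 2 - lucasU m n.

Lemma lucasU_rec m n : lucasU m n.+2 = lucasU m n.+1 - m * lucasU m n.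
Proof. by []. Qed.

(** Four times this is L_n^2 + (4m-1) U_n^2 = 4 m^n; the form without the factor 4 spares a division
    in the argument mod 8. *)
Lemma lucasU_form m n :
  lucasU m n.+1 ^+ 2 - lucasU m n * lucasU m n.+1 + m * lucasU m n ^+ 2 = m ^+ n.
Proof.
elim: n => [|n IHn]; first by rewrite /= expr0; ring.
by rewrite lucasU_rec (exprS m n) -IHn; ring.
Qed.

Lemma dvdz_lucasU_sub1 m n : (m %| lucasU m n.+1 - 1)%Z.
Proof.
elim: n => [|n IHn]; first by rewrite subrr dvdz0.
by rewrite lucasU_rec addrAC rpredB // dvdz_mulr.
Qed.

(** U_{n+2} and U_{n+1} are both 1 mod [m], so L_{n+1} is 2 - 1 = 1. The shift matters: L_0 = 2 can
    share a factor with [m]. *)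
Lemma coprimez_lucasL m n : coprimez m (lucasL m n.+1).
Proof.
have /dvdzP[k Hk] : (m %| lucasL m n.+1 - 1)%Z.
  have -> : lucasL m n.+1 - 1 =
      (lucasU m n.+2 - 1) *+ 2 - (lucasU m n.+1 - 1) by rewrite /lucasL; ring.
  by rewrite rpredB ?rpredMn ?dvdz_lucasU_sub1.
apply/coprimezP; exists (- k, 1) => /=.
by rewrite mul1r mulNr -Hk; ring.
Qed.

Lemma lucasL_powers (K : comPzRingType) (m : int) (a b : K) n :
  a + b = 1 -> a * b = m%:~R -> (lucasL m n)%:~R = a ^+ n + b ^+ n.
Proof.
move=> sab pab.
(* The recurrence has order two, so the induction carries two consecutive indices. *)
suff /(_ n)[] : forall n, (lucasL m n)%:~R = a ^+ n + b ^+ n /\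
  (lucasL m n.+1)%:~R = a ^+ n.+1 + b ^+ n.+1 by [].
elim=> [|k [IH0 IH1]].
  by split; rewrite /lucasL /= ?expr0 ?expr1 ?sab ?mulr0 ?subr0.
split=> //.
have -> : lucasL m k.+2 = lucasL m k.+1 - m * lucasL m k.
  by rewrite /lucasL !lucasU_rec; ring.
rewrite rmorphB rmorphM /= IH0 IH1 -pab -[a ^+ _ + _]mul1r -sab !exprS.
by ring.
Qed.

Lemma dvdz_prime_mul (p : nat) (x y : int) : prime p ->
  (p%:Z %| x * y)%Z = (p%:Z %| x)%Z || (p%:Z %| y)%Z.
Proof. by move=> p_pr; rewrite !dvdzE abszM Euclid_dvdM. Qed.

Lemma dvdz_prime_exp (p : nat) (x : int) n : prime p ->
  (p%:Z %| x ^+ n)%Z = (p%:Z %| x)%Z && (0 < n)%N.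
Proof. by move=> p_pr; rewrite !dvdzE abszX Euclid_dvdX. Qed.

Lemma sqr_odd_mod8 (w : int) : ~~ (2 %| w)%Z -> (8 %| w ^+ 2 - 1)%Z.
Proof.
move=> w_odd.
have [k ->] : exists k : int, w = k * 2 + 1 by exists (w %/ 2)%Z; lia.
have [j [-> | ->]] : exists j : int, k = j * 2 \/ k = j * 2 + 1
  by exists (k %/ 2)%Z; lia.
- by apply/dvdzP; exists (2 * j ^+ 2 + j); ring.
- by apply/dvdzP; exists (2 * j ^+ 2 + 3 * j + 1); ring.
Qed.

Lemma lucasL_dvd8 m n :
  (8 %| lucasL m (2 * n + 1))%Z -> (4 * m ^+ 2 - m = 1 %[mod 8])%Z.
Proof.
move=> L8.
have m_odd : ~~ (2 %| m)%Z.
  apply/negP => m2; have := coprimez_lucasL m (2 * n).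
  by rewrite -addn1 => /(coprimez_dvdl m2) /(coprimez_dvdr L8).
have := lucasU_form m (2 * n + 1).
case/dvdzP: L8 => k; rewrite /lucasL.
set v := lucasU m _.+1; set u := lucasU m _ => Lk form.
(* From 2v - u = 8k follows u = 2w: [w] is half of U_N. *)
pose w := v - 4 * k.
have wE : (4 * m - 1) * w ^+ 2 + 16 * k ^+ 2 = m * (m ^+ n) ^+ 2.
  have -> : m * (m ^+ n) ^+ 2 = m ^+ (2 * n + 1).
    by rewrite addn1 (exprS m) mulnC exprM.
  rewrite -form.
  have -> : u = v *+ 2 - k * 8 by rewrite -Lk; ring.
  by rewrite /w; ring.
have mn_odd : ~~ (2 %| m ^+ n)%Z.
  by rewrite (@dvdz_prime_exp 2) // negb_and m_odd.
have /dvdzP[i mi] := sqr_odd_mod8 m_odd.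
have /dvdzP[j mj] := sqr_odd_mod8 mn_odd.
(* An even [w] would make the left side of [wE] even, while the right side is odd. *)
have w_odd : ~~ (2 %| w)%Z.
  apply/negP => /dvdzP[l lE]; move: wE m_odd.
  have -> : (m ^+ n) ^+ 2 = j * 8 + 1 by rewrite -mj; ring.
  rewrite lE => wE /negP; apply; apply/dvdzP.
  exists ((4 * m - 1) * 2 * l ^+ 2 + 8 * k ^+ 2 - 4 * m * j).
  transitivity (m * (j * 8 + 1) - 8 * m * j); first by ring.
  by rewrite -wE; ring.
have /dvdzP[h wh] := sqr_odd_mod8 w_odd.
have m3 : 4 * m - 1 + 8 * ((4 * m - 1) * h + 2 * k ^+ 2 - m * j) = m.
  have e : (4 * m - 1) * (h * 8 + 1) + 16 * k ^+ 2 = m * (j * 8 + 1).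
    by rewrite -mj -wh !subrK.
  transitivity ((4 * m - 1) * (h * 8 + 1) + 16 * k ^+ 2 - m * j * 8).
    by ring.
  by rewrite e; ring.
move: m3; set T := (_ * h + _ - _) => m3.
apply/eqP; rewrite eqz_mod_dvd; apply/dvdzP; exists (4 * i + m + 3 * T).
(* [m3] says 3m = 1 - 8T; multiplying by 3, its own inverse mod 8, gives m = 3 mod 8. Then 4m^2 - m
   = 4 - 3 = 1 mod 8. *)
have m_eq : m = 3 - 8 * (m + 3 * T) by clearbody T; clear -m3; lia.
transitivity (4 * (m ^+ 2 - 1) + (3 - m)); first by ring.
by rewrite mi {1}m_eq; ring.
Qed.

(** As [w] is a unit mod [p], so are [c] and [u], and [c] is the square of w/u. *)
Lemma legendre_eq1 (p : nat) (c u w : int) : prime p ->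
  (p%:Z %| c * u ^+ 2 - w ^+ 2)%Z -> ~~ (p%:Z %| w)%Z -> legendre c p = 1.
Proof.
move=> p_pr cuw pw.
have pcu : ~~ (p%:Z %| c * u ^+ 2)%Z.
  apply: contra pw => pcu; move: (rpredB pcu cuw).
  by rewrite subKr dvdz_prime_exp // andbT.
move: pcu; rewrite dvdz_prime_mul // dvdz_prime_exp // andbT negb_or.
case/andP=> pc pu; rewrite /legendre (negbTE pc).
suff -> : [exists x : 'I_p, ((x : nat)%:Z ^+ 2 == c %[mod p%:Z])%Z] by [].
(* Bezout makes [t] an inverse of [u] mod [p]; the square root of [c] is t w, reduced mod [p]. *)
have /coprimezP[[s t] /= st] : coprimez p%:Z u.
  by rewrite coprimezE prime_coprime // -dvdzE.
have p_gt0 := prime_gt0 p_pr.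
have p_neq0 : p%:Z != 0 by lia.
have xp : (`|(t * w) %% p%:Z|%Z < p)%N.
  by rewrite -ltz_nat gez0_abs ?modz_ge0 // ltz_pmod //; lia.
apply/existsP; exists (Ordinal xp) => /=.
rewrite gez0_abs ?modz_ge0 // modzXm eqz_mod_dvd.
have -> : (t * w) ^+ 2 - c =
    p%:Z * (c * s * (s * p%:Z - 2)) - t ^+ 2 * (c * u ^+ 2 - w ^+ 2).
  have tu : t * u = 1 - s * p%:Z by rewrite -st; ring.
  transitivity ((t * w) ^+ 2 - c * (t * u) ^+ 2 + c * ((1 - s * p%:Z) ^+ 2 - 1)).
    by rewrite tu; ring.
  by ring.
by apply: rpredB; [apply: dvdz_mulr | apply: dvdz_mull].
Qed.

Lemma lucasL_dvd_prime m n p : prime p -> odd p ->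
  (p%:Z %| lucasL m (2 * n + 1))%Z -> legendre (4 * m ^+ 2 - m) p = 1.
Proof.
move=> p_pr p_odd pL.
have pm : ~~ (p%:Z %| m)%Z.
  apply/negP => pm; have := coprimez_lucasL m (2 * n).
  rewrite -addn1 => /(coprimez_dvdl pm) /(coprimez_dvdr pL).
  by rewrite coprimezE /coprime gcdnn => /eqP /= p1; rewrite p1 in p_pr.
apply: (@legendre_eq1 _ _ (lucasU m (2 * n + 1)) (2 * m ^+ n.+1)) => //.
  (* The difference is exactly -m L_N^2. *)
  have -> : (4 * m ^+ 2 - m) * lucasU m (2 * n + 1) ^+ 2 - (2 * m ^+ n.+1) ^+ 2
      = lucasL m (2 * n + 1) * (- m * lucasL m (2 * n + 1)).
    have -> : (2 * m ^+ n.+1) ^+ 2 = 4 * m * m ^+ (2 * n + 1).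
      by rewrite addn1 !(exprS m) [(2 * n)%N]mulnC exprM; ring.
    by rewrite -(lucasU_form m (2 * n + 1)) /lucasL; ring.
  exact: dvdz_mulr.
(* Only p | 2 is left to exclude, which is where [p] odd enters. *)
rewrite dvdz_prime_mul // dvdz_prime_exp // (negbTE pm) orbF.
apply/negP; rewrite dvdzE /= => /(@dvdn_leq _ 2 isT) p_le2.
by have := prime_gt1 p_pr; lia.
Qed.

Theorem theorem5p1 (R : realType) (m : int) (a b : R[i])
    (hab : 'X^2 - 'X + (m%:~R)%:P = ('X - a%:P) * ('X - b%:P) :> {poly R[i]}) :
  exists L : nat -> int,
    [/\ forall n : nat, (L n)%:~R = a ^+ n + b ^+ n,
        (exists n : nat, (2 ^+ 3 %| L (2 * n + 1)%N)%Z) ->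
          (4 * m ^+ 2 - m = 1 %[mod 8])%Z
      & forall p : nat, prime p -> odd p ->
          (exists n : nat, (p%:Z %| L (2 * n + 1)%N)%Z) ->
          legendre (4 * m ^+ 2 - m) p = 1].
Proof.
(* Evaluating at 0 gives the product of the roots, and then at 1 their sum. *)
have habE x : x ^+ 2 - x + m%:~R = (x - a) * (x - b).
  by have := congr1 (horner^~ x) hab; rewrite !hornerE.
have pab : a * b = m%:~R by have := habE 0; rewrite !sub0r mulrNN => <-; ring.
have sab : a + b = 1.
  have /eqP := habE 1; rewrite -pab -subr_eq0 => /eqP e.
  by apply/eqP; rewrite -subr_eq0 -e; apply/eqP; ring.
exists (lucasL m); split.
- by move=> n; apply: lucasL_powers.
- by case=> n; apply: lucasL_dvd8.
- by move=> p p_pr p_odd [n]; apply: lucasL_dvd_prime.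
Qed.
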